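(* Let $F$ be a proper lower semicontinuous function on $\mathbb{R}^n$. Suppose that $F$ satisfies the Kurdyka-Łojasiewicz (KL) property at $\overline x$ with exponent $\alpha\in(0,1)$ over $\mathfrak{B}(\overline x;\eta,\nu)$. Then: (a) $F$ satisfies the level-set sharpness condition at $\overline x$ with exponent $\beta=1-\alpha$ over $\mathfrak{B}(\overline x;\frac\eta2,\nu)$. (b) Moreover, $F$ satisfies the level-set subdifferential error bound at $\overline x$ with exponent $\gamma=\frac\alpha{1-\alpha}$ over $\mathfrak{B}(\overline x;\frac\eta2,\nu)$. So $\alpha=\frac\gamma{1+\gamma}$. As a consequence, $\alpha\in(0,\frac12]$ if and only if $\gamma\in(0,1]$, and $\alpha\in(\frac12,1)$ if and only if $\gamma>1$.
   Context: Let $\overline F=F(\overline x)$, $[F\le\overline F]=\{x:F(x)\le\overline F\}$, $\mathrm{dist}(x,C)=\inf_{z\in C}\|x-z\|$ ($=\infty$ if $C=\emptyset$), $\mathbb{B}(\overline x;\eta)$ the open ball, and for $\eta,\nu>0$ $\mathfrak{B}(\overline x;\eta,\nu)=\mathbb{B}(\overline x;\eta)\cap\{x:\overline F<F(x)<\overline F+\nu\}$. $\partial_P F(\bar x)=\{\xi:\exists\rho>0,r>0\text{ s.t. }F(x)\ge F(\bar x)+\langle\xi,x-\bar x\rangle-\rho\|x-\bar x\|^2\ \forall x\in\mathbb{B}(\bar x;r)\}$ is the proximal subdifferential. $\partial_LF$ is the limiting (Mordukhovich) subdifferential. KL property at $\overline x$ with exponent $\alpha$ over $\mathfrak{B}(\overline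 x;\eta,\nu)$: there is $c_1>0$ with $\mathrm{dist}(0,\partial_LF(x))\ge c_1[F(x)-\overline F]^\alpha$ for all $x\in\mathfrak{B}(\overline x;\eta,\nu)$. Level-set sharpness at $\overline x$ with exponent $\beta>0$ over a set $S$: there is $c_2>0$ with $\mathrm{dist}(x,[F\le\overline F])\le c_2(F(x)-\overline F)^\beta$ for all $x\in S$. Level-set subdifferential error bound at $\overline x$ with exponent $\gamma>0$ over a set $S$: there is $c_3>0$ with $\mathrm{dist}^\gamma(x,[F\le\overline F])\le c_3\,\mathrm{dist}(0,\partial_PF(x))$ for all $x\in S$. *)

(* Defs.v *)
From HB Require Import structures.
From mathcomp Require Import all_boot all_order all_algebra.
From mathcomp Require Import all_classical all_reals all_analysis.

Set Implicit Arguments.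
Unset Strict Implicit.
Unset Printing Implicit Defensive.

Import Order.TTheory GRing.Theory Num.Theory.
Import numFieldNormedType.Exports.

Local Open Scope classical_set_scope.
Local Open Scope ring_scope.

Section Defs.
Context {R : realType} {n : nat}.
Implicit Types (x y z xbar xi : 'rV[R]_n) (C S : set 'rV[R]_n).
Implicit Types (F : 'rV[R]_n -> \bar R) (eta nu alpha beta gamma : R).

Definition dotv x y : R := \sum_(i < n) x 0 i * y 0 i.

(* The library norm `|x| on 'rV[R]_n is the sup norm, hence this definition;
   both norms induce the library topology of 'rV[R]_n. *)
Definition enorm x : R := Num.sqrt (dotv x x).

Definition eball xbar eta : set 'rV[R]_n := [set x | enorm (x - xbar) < eta].

(* ereal_inf set0 = +oo, so the distance to the empty set is +oo. *)
Definition dist_to x C : \bar R := ereal_inf [set (enorm (x - z))%:E | z in C].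

Definition proper_function F : Prop :=
  (forall x, F x != -oo%E) /\ exists x, (F x < +oo)%E.

Definition sublevel F xbar : set 'rV[R]_n := [set x | (F x <= F xbar)%E].

Definition level_ball F xbar eta nu : set 'rV[R]_n :=
  eball xbar eta `&` [set x | (F xbar < F x < F xbar + nu%:E)%E].

(* The subdifferentials are empty outside the domain of F. *)
Definition proximal_subdiff F x : set 'rV[R]_n := [set xi |
  F x \is a fin_num /\
  exists rho r : R, [/\ 0 < rho, 0 < r & forall y, eball x r y ->
    (F x + (dotv xi (y - x) - rho * enorm (y - x) ^+ 2)%:E <= F y)%E]].

(* F y >= F x + <xi, y - x> - o(|y - x|) as y tends to x *)
Definition frechet_subdiff F x : set 'rV[R]_n := [set xi |
  F x \is a fin_num /\
  forall eps : R, 0 < eps -> exists2 r : R, 0 < r & forall y, eball x r y ->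
    (F x + (dotv xi (y - x) - eps * enorm (y - x))%:E <= F y)%E].

(* Limits of Frechet subgradients along F-attentive convergent sequences *)
Definition limiting_subdiff F x : set 'rV[R]_n := [set xi |
  F x \is a fin_num /\
  exists x_ xi_ : nat -> 'rV[R]_n,
    [/\ forall k, frechet_subdiff F (x_ k) (xi_ k),
        x_ @ \oo --> x, F \o x_ @ \oo --> F x & xi_ @ \oo --> xi]].

(* In the next three definitions `^ is the extended real power poweR, with
   +oo `^ a = +oo for a > 0. *)
Definition kl_property F xbar alpha S : Prop :=
  exists2 c1 : R, 0 < c1 & forall x, S x ->
    (c1%:E * (F x - F xbar) `^ alpha <= dist_to 0%R (limiting_subdiff F x))%E.

Definition level_sharpness F xbar beta S : Prop :=
  0 < beta /\ exists2 c2 : R, 0 < c2 & forall x, S x ->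
    (dist_to x (sublevel F xbar) <= c2%:E * (F x - F xbar) `^ beta)%E.

Definition level_error_bound F xbar gamma S : Prop :=
  0 < gamma /\ exists2 c3 : R, 0 < c3 & forall x, S x ->
    ((dist_to x (sublevel F xbar)) `^ gamma
       <= c3%:E * dist_to 0%R (proximal_subdiff F x))%E.

End Defs.

(* Main.v *)
Require Import Defs.
From HB Require Import structures.
From mathcomp Require Import all_boot all_order all_algebra.
From mathcomp Require Import all_classical all_reals all_analysis.
From mathcomp Require Import finmap ring lra.
Set Implicit Arguments.
Unset Strict Implicit.
Unset Printing Implicit Defensive.
Import Order.TTheory GRing.Theory Num.Theory.
Import numFieldNormedType.Exports.
Local Open Scope classical_set_scope.
Local Open Scope ring_scope.

(** The value [F xbar] is finite unless the level balls are empty; write [b] for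
it, [q = 1 - alpha], and [L] for the sublevel set [F <= b].

Sharpness. Fix [x] in the half-size ball with [F x = b + u], and a radius [l]
smaller than the distance from [x] to [L]. The aim is to show
[l <= 2 / (q * c1) * u ^ q]. Desingularise [F] to [(F - b) ^ q] and add the
quadratic penalty [k * |y - x| ^ 2], where [k = u ^ q / l ^ 2] is chosen so that
the penalty alone reaches the value [u ^ q] of the sum at [x] as soon as
[|y - x| = l]. A minimiser [z] of the sum over the closed ball of radius [l]
exists by compactness, lies strictly inside that ball, hence outside [L], and
satisfies [F z <= F x]. As [xbar] is in [L], [|z - x| < l <= |x - xbar|], so that
[|z - xbar| < 2 |x - xbar| < eta]: this is why the radius is halved. At [z] the penalty is smooth with gradient of norm at
most [2 k l = 2 u ^ q / l], so [(F - b) ^ q] has a proximal subgradient of that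
norm at [z]. The concavity of [t ^ q] turns it into one of [F], multiplied by
the factor [(F z - b) ^ alpha / q] (penalised_min_proximal_subgrad,
exists_small_proximal_subgrad). A proximal subgradient is a limiting one, so the
KL inequality at [z] applies to it; the factor [(F z - b) ^ alpha] cancels and
what remains is the bound on [l] (level_sharpness_of_kl).

A quadratic penalty is used rather than the linear one of Ekeland's variational
principle: it costs a factor 2 in the constant, but being smooth it yields an
exact subgradient at [z] without any sum rule for limiting subdifferentials.

Error bound. Raising the sharpness inequality to the power
[gamma = alpha / (1 - alpha)] bounds the left-hand side by a multiple of
[(F x - b) ^ alpha], which the KL inequality at [x] bounds by the distance from 0
to the limiting subdifferential, hence to the smaller proximal one. *)

(** * The Euclidean norm of row vectors *)

Section EuclideanNorm.
Context {R : realType} {n : nat}.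
Implicit Types x y z : 'rV[R]_n.

Lemma dotv_ge0 x : 0 <= dotv x x.
Proof. by apply: sumr_ge0 => i _; rewrite -expr2 sqr_ge0. Qed.

Lemma sqr_enorm x : enorm x ^+ 2 = dotv x x.
Proof. by rewrite sqr_sqrtr // dotv_ge0. Qed.

Lemma enorm_ge0 x : 0 <= enorm x.
Proof. exact: sqrtr_ge0. Qed.

Lemma dotvZl a x y : dotv (a *: x) y = a * dotv x y.
Proof. by rewrite mulr_sumr; apply: eq_bigr => i _; rewrite mxE mulrA. Qed.

Lemma dotvZr a x y : dotv x (a *: y) = a * dotv x y.
Proof. by rewrite mulr_sumr; apply: eq_bigr => i _; rewrite mxE mulrCA. Qed.

Lemma sqr_enormD x y :
  enorm (x + y) ^+ 2 = enorm x ^+ 2 + 2 * dotv x y + enorm y ^+ 2.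
Proof.
rewrite !sqr_enorm mulr_sumr -!big_split /=; apply: eq_bigr => i _.
by rewrite !mxE; ring.
Qed.

Lemma enormZ a x : enorm (a *: x) = `|a| * enorm x.
Proof.
by rewrite /enorm dotvZl dotvZr mulrA -expr2 sqrtrM ?sqr_ge0// sqrtr_sqr.
Qed.

Lemma enormBC x y : enorm (x - y) = enorm (y - x).
Proof. by rewrite -opprB -scaleN1r enormZ normrN1 mul1r. Qed.

Lemma coord_le_enorm x i : `|x 0 i| <= enorm x.
Proof.
rewrite -sqrtr_sqr ler_sqrt ?dotv_ge0 // /dotv (bigD1 i)//= -expr2 lerDl.
by apply: sumr_ge0 => j _; rewrite -expr2 sqr_ge0.
Qed.

(** Cauchy-Schwarz, by expanding the square of [|y| x - |x| y]. *)
Lemma dotv_le_enorm x y : dotv x y <= enorm x * enorm y.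
Proof.
have zero (v : 'rV[R]_n) : enorm v = 0 -> v = 0.
  move=> v0; apply/rowP => i; apply/eqP; rewrite mxE -normr_le0.
  by have := coord_le_enorm v i; rewrite v0.
have [x0|x_neq0] := eqVneq (enorm x) 0.
  by rewrite x0 mul0r (zero _ x0) /dotv big1 // => i _; rewrite mxE mul0r.
have [y0|y_neq0] := eqVneq (enorm y) 0.
  by rewrite y0 mulr0 (zero _ y0) /dotv big1 // => i _; rewrite mxE mulr0.
have xy_gt0 : 0 < enorm x * enorm y.
  by rewrite mulr_gt0 // lt_def enorm_ge0 ?x_neq0 ?y_neq0.
have := sqr_ge0 (enorm (enorm y *: x + (- enorm x) *: y)).
rewrite sqr_enormD !enormZ dotvZl dotvZr normrN !ger0_norm ?enorm_ge0 // => le0.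
rewrite -(ler_pM2l xy_gt0); nra.
Qed.

Lemma ler_enormD x y : enorm (x + y) <= enorm x + enorm y.
Proof.
rewrite -ler_sqr ?nnegrE ?addr_ge0 ?enorm_ge0 // sqr_enormD.
have := dotv_le_enorm x y; nra.
Qed.

Lemma enorm_continuous : continuous (@enorm R n).
Proof.
move=> x; apply: (@continuous_comp _ _ _ (fun y => dotv y y) Num.sqrt); last first.
  exact: sqrt_continuous.
move: x; rewrite /dotv; apply: continuous_big => [|i _]; first exact: add_continuous.
by move=> x; apply: continuousM; exact: coord_continuous.
Qed.

Lemma enormB_continuous x : continuous (fun y => enorm (y - x)).
Proof.
move=> y; apply: (@continuous_comp _ _ _ (fun y => y - x) enorm); last first.
  exact: enorm_continuous.
apply: continuousB; [exact: cvg_id|].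
exact: cst_continuous.
Qed.

(** Bounded sets are those of the sup norm, which is at most the Euclidean one. *)
Lemma compact_eball x (l : R) : compact [set y | enorm (y - x) <= l].
Proof.
apply: bounded_closed_compact.
  exists (l + `|x|); split; first exact: num_real.
  move=> M lM y /= yx; apply: le_trans (ltW lM).
  rewrite -(subrK x y); apply: le_trans (ler_normD _ _) _.
  rewrite lerD2r; apply: le_trans yx.
  rewrite /Num.norm/= mx_normrE; apply: bigmax_le; first exact: enorm_ge0.
  by move=> [i j] _ /=; rewrite [i]ord1; exact: coord_le_enorm.
rewrite (_ : [set _ | _] = (fun y => enorm (y - x)) @^-1` [set r | r <= l])//.
by apply: closed_comp => [y _|]; [exact: enormB_continuous|exact: closed_le].
Qed.

End EuclideanNorm.

(** * Lower semicontinuous functions *)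

Section LowerSemicontinuity.
Context {R : realType}.

(** Weierstrass. Were there no minimiser, the open sets [f z < f y], for [z] in
[K], would cover [K]; among the finitely many [z] of a subcover, the one with the
smallest value would belong to none of its members. *)
Lemma lsc_compact_min (T : ptopologicalType) (f : T -> R) (K : set T) x0 :
  lower_semicontinuous (EFin \o f) -> compact K -> K x0 ->
  exists2 z, K z & forall y, K y -> f z <= f y.
Proof.
move=> f_lsc + Kx0; rewrite compact_cover => Kc; apply: contrapT => nomin.
have better y : K y -> exists2 z, K z & f z < f y.
  move=> Ky; apply: contrapT => nz; apply: nomin; exists y => // z Kz.
  by rewrite leNgt; apply/negP => fzy; apply: nz; exists z.
pose U (z : T) := [set y | f z < f y].
have [|y /better[z Kz fzy]|D DK KD] := Kc T K U.
- by move=> z _; have /lower_semicontinuousP/(_ (f z)) := f_lsc;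
    rewrite /comp/=; under eq_set do rewrite lte_fin.
- by exists z.
have [z0 z0D _] := KD _ Kx0.
have [/= z zD zmin] := @arg_minP _ _ _ [` z0D]%fset xpredT (f \o val) isT.
have /set_mem/KD[y yD] := DK _ (valP z).
by rewrite /U/= ltNge (zmin [` yD]%fset).
Qed.

Lemma lsc_add_continuous (T : topologicalType) (f g : T -> R) :
  lower_semicontinuous (EFin \o f) -> continuous g ->
  lower_semicontinuous (EFin \o (fun x => f x + g x)).
Proof.
move=> f_lsc g_cont x a /=; rewrite lte_fin => a_lt.
pose e := (f x + g x - a) / 2.
have e_gt0 : 0 < e by rewrite divr_gt0 // subr_gt0.
have [|V Vx Vf] := f_lsc x (f x - e).
  by rewrite lte_fin ltrBlDr ltrDl.
have Wx : \forall y \near x, `|g x - g y| < e.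
  by have /cvgrPdist_lt := g_cont x; exact.
exists (V `&` [set y | `|g x - g y| < e]); first exact: filterI.
move=> y [/Vf /=]; rewrite !lte_fin ltr_norml => fy /andP[_ gy].
by rewrite /e in fy gy; lra.
Qed.

Lemma lsc_powR (T : topologicalType) (f : T -> R) (q : R) :
  0 < q -> (forall x, 0 <= f x) -> lower_semicontinuous (EFin \o f) ->
  lower_semicontinuous (EFin \o (fun x => f x `^ q)).
Proof.
move=> q_gt0 f_ge0 f_lsc x a /=; rewrite lte_fin => a_lt.
have [a_lt0|a_ge0] := ltP a 0.
  by exists setT => [|y _]; [exact: filterT|rewrite lte_fin (lt_le_trans a_lt0) ?powR_ge0].
have aK : (a `^ q^-1) `^ q = a by rewrite -powRrM mulVf ?gt_eqF // powRr1.
have [|V Vx Vf] := f_lsc x (a `^ q^-1).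
  rewrite lte_fin ltNge; apply/negP => /(ge0_ler_powR (ltW q_gt0)).
  by rewrite !nnegrE aK powR_ge0 f_ge0 => /(_ isT isT); rewrite leNgt a_lt.
exists V => // y /Vf /=; rewrite !lte_fin => /(gt0_ltr_powR q_gt0).
by rewrite !nnegrE aK powR_ge0 f_ge0 => /(_ isT isT).
Qed.

End LowerSemicontinuity.

Section TruncatedExcess.
Context {R : realType} {T : topologicalType}.
Context (F : T -> \bar R) (b M : R) (M_gt0 : 0 < M).

(** The excess [F - b] clipped to the interval [[0, M]]: it is real-valued
everywhere, so its real powers can be minimised, and it coincides with [F - b] at
the points where the clipped value lies strictly between 0 and [M]. *)
Definition truncated_excess (y : T) : R :=
  match F y with
  | r%:E => Num.max 0 (Num.min (r - b) M)
  | +oo%E => M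
  | -oo%E => 0
  end.

Lemma truncated_excess_ge0 y : 0 <= truncated_excess y.
Proof. by rewrite /truncated_excess; case: (F y) => [r||]//; rewrite ?le_max ?lexx // ltW. Qed.

Lemma lt_truncated_excess y a : 0 <= a ->
  (a < truncated_excess y) = (a < M) && ((b + a)%:E < F y)%E.
Proof.
move=> a_ge0; rewrite /truncated_excess; case: (F y) => [r||].
- by rewrite lt_max ltNge a_ge0 /= lt_min lte_fin ltrBrDl andbC.
- by rewrite ltry andbT.
- by rewrite ltNge a_ge0 /= andbF.
Qed.

Lemma truncated_excess_fin y c : 0 <= c <= M -> F y = (b + c)%:E ->
  truncated_excess y = c.
Proof.
move=> /andP[c_ge0 c_le] Fy; rewrite /truncated_excess Fy addrC addKr.
by rewrite min_l // max_r.
Qed.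

Lemma finite_of_truncated_excess y : 0 < truncated_excess y < M ->
  F y = (b + truncated_excess y)%:E.
Proof.
rewrite /truncated_excess; case: (F y) => [r||]; rewrite ?ltxx ?andbF //.
rewrite lt_max ltxx lt_min /= => /andP[/andP[rb _] +].
by rewrite max_r ?le_min ?(ltW rb) ?(ltW M_gt0) // gt_min ltxx orbF => rM;
  rewrite min_l ?(ltW rM) // addrC subrK.
Qed.

Lemma truncated_excess_le y : (b%:E < F y)%E ->
  ((b + truncated_excess y)%:E <= F y)%E.
Proof.
rewrite /truncated_excess; case: (F y) => [r||]//; last by rewrite leey.
rewrite lte_fin lee_fin -lerBrDl ge_max subr_ge0 => /ltW -> /=.
by rewrite ge_min lexx.
Qed.

Lemma lsc_truncated_excess : lower_semicontinuous F ->
  lower_semicontinuous (EFin \o truncated_excess).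
Proof.
move=> F_lsc x a /=; rewrite lte_fin => a_lt.
have [a_lt0|a_ge0] := ltP a 0.
  by exists setT => [|y _]; [exact: filterT|rewrite lte_fin (lt_le_trans a_lt0) ?truncated_excess_ge0].
move: a_lt; rewrite lt_truncated_excess // => /andP[aM /F_lsc[V Vx VF]].
by exists V => // y /VF; rewrite lte_fin lt_truncated_excess // aM.
Qed.

End TruncatedExcess.

(** * Variation of real powers *)

(** The graph of the concave function [t ^ q] lies below its tangent at [A]; the
inequality is solved for [w]. After clearing denominators it is Young's
inequality for the product [w ^ q * A ^ (1 - q)]. *)
Lemma powR_tangent (R : realType) (q w A : R) : 0 < q < 1 -> 0 <= w -> 0 < A ->
  A + A `^ (1 - q) / q * (w `^ q - A `^ q) <= w.
Proof.
move=> /andP[q_gt0 q_lt1] w_ge0 A_gt0.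
have p_gt0 : 0 < 1 - q by rewrite subr_gt0.
have A_ge0 := ltW A_gt0.
have := @conjugate_powR R (w `^ q) (A `^ (1 - q)) q^-1 (1 - q)^-1
  (powR_ge0 _ _) (powR_ge0 _ _).
rewrite !invr_gt0 !invrK -!powRrM !mulfV ?gt_eqF // !powRr1 //.
move=> /(_ q_gt0 p_gt0); rewrite addrC subrK => /(_ erefl) young.
have AA : A `^ (1 - q) * A `^ q = A.
  by rewrite -powRD ?subrK ?powRr1 // gt_eqF // implybT.
rewrite -lerBrDl mulrAC mulrBr AA [_ * w `^ q]mulrC ler_pdivrMr //.
nra.
Qed.

(** * Proximal subgradients from penalised minimisation *)

Section PenalisedMinimisation.
Context {R : realType} {n : nat}.
Implicit Types (F : 'rV[R]_n -> \bar R) (x y z xi : 'rV[R]_n).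

(** Within distance [eps / rho] the quadratic error of a proximal subgradient is
below the linear error [eps], so a proximal subgradient is a Frechet one; constant
sequences make it a limiting one. *)
Lemma proximal_subdiff_sub_limiting F x :
  proximal_subdiff F x `<=` limiting_subdiff F x.
Proof.
move=> xi [Fx [rho [r [rho_gt0 r_gt0 H]]]]; split => //.
exists (fun=> x), (fun=> xi); split; [|exact: cvg_cst..].
move=> _; split => // eps eps_gt0; exists (Num.min r (eps / rho)).
  by rewrite lt_min r_gt0 divr_gt0.
move=> y; rewrite /eball /= lt_min => /andP[yr ye]; apply: le_trans (H y yr).
rewrite leeD2l // lee_fin lerD2l lerN2 expr2 mulrA.
apply: ler_wpM2r; first exact: enorm_ge0.
by rewrite mulrC -ler_pdivlMr // ltW.
Qed.

(** Expanding [|y - x| ^ 2] around [z], minimality says that [(F - b) ^ q] has the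
proximal subgradient [- 2 k (z - x)] at [z]. The derivative of the inverse
function [s ^ (1 / q)] at [A ^ q] is [A ^ (1 - q) / q], and by [powR_tangent] this
convex function lies above its tangent; so multiplying by that factor gives a
proximal subgradient of [F] itself. Truncating the excess only lowers it, so a
minorant of the truncated excess is one of [F - b]. *)
Lemma penalised_min_proximal_subgrad F x z (b M q k l A : R) :
  0 < M -> 0 < q < 1 -> 0 < k -> enorm (z - x) < l ->
  (forall y, enorm (y - x) < l -> (b%:E < F y)%E) ->
  0 < A -> F z = (b + A)%:E ->
  (forall y, enorm (y - x) < l ->
    A `^ q + k * enorm (z - x) ^+ 2 <=
      truncated_excess F b M y `^ q + k * enorm (y - x) ^+ 2) ->
  proximal_subdiff F z (- (2 * (A `^ (1 - q) / q * k)) *: (z - x)).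
Proof.
move=> M_gt0 q01 k_gt0 zl bF A_gt0 Fz zmin; split; first by rewrite Fz.
have c_gt0 : 0 < A `^ (1 - q) / q.
  by rewrite divr_gt0 ?powR_gt0 //; case/andP: q01.
exists (A `^ (1 - q) / q * k), (l - enorm (z - x)).
split; [exact: mulr_gt0|by rewrite subr_gt0|].
move=> y; rewrite /eball /= ltrBrDr => yz.
have yx : enorm (y - x) < l.
  by apply: le_lt_trans yz; rewrite -{1}(subrK z y) -addrA ler_enormD.
apply: le_trans (truncated_excess_le M (bF y yx)).
rewrite Fz -EFinD lee_fin -addrA lerD2l.
have w_ge0 := truncated_excess_ge0 F b M_gt0 y.
apply: le_trans (powR_tangent q01 w_ge0 A_gt0).
rewrite lerD2l dotvZl.
have := zmin y yx.
have -> : enorm (y - x) ^+ 2 =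
    enorm (y - z) ^+ 2 + 2 * dotv (y - z) (z - x) + enorm (z - x) ^+ 2.
  by rewrite -sqr_enormD addrA subrK.
have -> : dotv (z - x) (y - z) = dotv (y - z) (z - x).
  by apply: eq_bigr => i _; rewrite mulrC.
move: (dotv _ _) => d hyp; rewrite -subr_ge0.
rewrite (_ : _ - _ = A `^ (1 - q) / q * (truncated_excess F b M y `^ q +
  k * (enorm (y - z) ^+ 2 + 2 * d) - A `^ q)); last by ring.
by apply: mulr_ge0; [exact: ltW|lra].
Qed.

(** If [F] stays above [b] on the ball of radius [l] around [x], then some
subgradient inside that ball is controlled by the drop from [F x] to [b]: once
divided by [A ^ (1 - q)], the slope is at most that of descending from [u ^ q]
to 0 over the distance [l], up to the factor [2 / q]. *)
Lemma exists_small_proximal_subgrad F x (b q u l : R) :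
  lower_semicontinuous F -> 0 < q < 1 -> 0 < u -> 0 < l ->
  F x = (b + u)%:E ->
  (forall y, enorm (y - x) <= l -> (b%:E < F y)%E) ->
  exists z A xi, [/\ enorm (z - x) < l, 0 < A <= u, F z = (b + A)%:E,
    proximal_subdiff F z xi & enorm xi <= 2 / q * (u `^ q / l) * A `^ (1 - q)].
Proof.
move=> F_lsc q01 u_gt0 l_gt0 Fx bF.
have /andP[q_gt0 q_lt1] := q01.
(* Any bound above [u] works: the minimiser has excess at most [u], hence is not
   affected by the truncation. *)
pose M := u + 1; have M_gt0 : 0 < M by rewrite addr_gt0.
pose w := truncated_excess F b M.
(* With this weight the penalty at distance [l] equals the value at [x]. *)
pose k := u `^ q / l ^+ 2.
have uq_gt0 : 0 < u `^ q by rewrite powR_gt0.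
have k_gt0 : 0 < k by rewrite divr_gt0 // exprn_gt0.
pose h y := w y `^ q + k * enorm (y - x) ^+ 2.
have h_lsc : lower_semicontinuous (EFin \o h).
  apply: lsc_add_continuous.
    apply: lsc_powR => //; first exact: truncated_excess_ge0.
    exact: lsc_truncated_excess.
  have sqr_cont : continuous (fun y => enorm (y - x) ^+ 2).
    move=> y; rewrite /continuous_at expr2; under eq_cvg do rewrite expr2.
    exact: (cvgM (@enormB_continuous _ _ x y) (@enormB_continuous _ _ x y)).
  by move=> y; exact: cvgMl_tmp (@sqr_cont y).
have nx0 : enorm (x - x) = 0 by rewrite subrr -(scale0r x) enormZ normr0 mul0r.
have wx : w x = u.
  by apply: truncated_excess_fin => //; rewrite ltW //= lerDl.
have xl : [set y | enorm (y - x) <= l] x by rewrite /= nx0 ltW.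
have [z /= zl zmin] :=
  @lsc_compact_min R _ h [set y | enorm (y - x) <= l] x h_lsc
    (@compact_eball R n x l) xl.
have hz : h z <= u `^ q.
  by have := zmin x; rewrite {2}/h nx0 wx expr0n mulr0 addr0; apply; exact: ltW.
have wz_gt0 : 0 < w z.
  by rewrite /w lt_truncated_excess // M_gt0 addr0 bF.
have wz_le : w z <= u.
  rewrite leNgt; apply/negP => /(gt0_ltr_powR q_gt0).
  rewrite !nnegrE !ltW // => /(_ isT isT); apply/negP; rewrite -leNgt.
  apply: le_trans hz; rewrite lerDl mulr_ge0 ?sqr_ge0 // ltW //.
have Fz : F z = (b + w z)%:E.
  apply: (@finite_of_truncated_excess _ _ _ _ M) => //.
  by rewrite wz_gt0 (le_lt_trans wz_le) // ltrDl.
have zl' : enorm (z - x) < l.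
  rewrite lt_neqAle zl andbT; apply/eqP => zx; move: hz.
  rewrite /h zx /k divfK ?gt_eqF ?exprn_gt0 //.
  by apply/negP; rewrite -ltNge ltrDr powR_gt0.
exists z, (w z), (- (2 * (w z `^ (1 - q) / q * k)) *: (z - x)).
split => //; first by rewrite wz_gt0.
  apply: (@penalised_min_proximal_subgrad _ _ _ b M _ _ l) => // y /ltW yl.
    exact: bF.
  exact: zmin.
have c_gt0 : 0 < w z `^ (1 - q) / q by rewrite divr_gt0 ?powR_gt0.
rewrite enormZ normrN ger0_norm; last by rewrite mulr_ge0 // mulr_ge0 // ltW.
rewrite (_ : 2 / q * _ * _ = 2 * (w z `^ (1 - q) / q * k) * l).
  by apply: ler_wpM2l; rewrite // mulr_ge0 // mulr_ge0 // ltW.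
by rewrite /k; field; rewrite !gt_eqF.
Qed.

End PenalisedMinimisation.

(** * Sharpness and error bounds of level sets *)

Section LevelSets.
Context {R : realType} {n : nat}.
Implicit Types (F : 'rV[R]_n -> \bar R) (x y z : 'rV[R]_n) (C S : set 'rV[R]_n).

Lemma dist_to_le x z C : C z -> (dist_to x C <= (enorm (x - z))%:E)%E.
Proof. by move=> Cz; apply: ereal_inf_lbound; exists z. Qed.

Lemma dist_to_ge0 x C : (0 <= dist_to x C)%E.
Proof. by apply: le_ereal_inf_tmp => _ [z _ <-]; rewrite lee_fin enorm_ge0. Qed.

Lemma dist_to_subset x C S : C `<=` S -> (dist_to x S <= dist_to x C)%E.
Proof. by move=> CS; apply: ereal_inf_le_tmp; exact: image_subset. Qed.

(** If the bound failed, some radius [l] would lie strictly between the right-hand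
side and the distance to the sublevel set. The subgradient obtained inside the
ball of radius [l] then violates the KL inequality. *)
Lemma level_sharpness_of_kl F xbar (eta nu alpha c1 : R) x :
  proper_function F -> lower_semicontinuous F -> 0 < alpha < 1 -> 0 < c1 ->
  (forall z, level_ball F xbar eta nu z ->
    (c1%:E * (F z - F xbar) `^ alpha <= dist_to 0 (limiting_subdiff F z))%E) ->
  level_ball F xbar (eta / 2) nu x ->
  (dist_to x (sublevel F xbar) <=
    (2 / ((1 - alpha) * c1))%:E * (F x - F xbar) `^ (1 - alpha))%E.
Proof.
move=> [F_gtNy _] F_lsc /andP[a_gt0 a_lt1] c1_gt0 kl [xball /= Fxx].
have := F_gtNy xbar; case Fb: (F xbar) Fxx => [b||] // Fxx _; last first.
  by move: Fxx; rewrite ltNge leey.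
have [u Fx] : exists u, F x = (b + u)%:E.
  case: (F x) Fxx => [r||]; rewrite ?ltNge ?leey ?leNye ?andbF //= => _.
  by exists (r - b); rewrite addrC subrK.
move: Fxx; rewrite Fx -EFinD !lte_fin ltrDl ltrD2l => /andP[u_gt0 u_lt].
have q01 : 0 < 1 - alpha < 1 by apply/andP; split; lra.
have /andP[q_gt0 _] := q01.
rewrite -EFinB [b + u - b]addrC addKr poweR_EFin -EFinM leNgt.
apply/negP; set t := _ * _; move=> t_lt.
have t_gt0 : 0 < t.
  by rewrite mulr_gt0 ?powR_gt0 // divr_gt0 // mulr_gt0.
have [l tl ld] : exists2 l, t < l & (l%:E < dist_to x (sublevel F xbar))%E.
  have := t_lt; case: (dist_to _ _) => [d||//].
    by rewrite lte_fin => td; exists ((t + d) / 2);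
      rewrite ?lte_fin ?midf_lt.
  by exists (t + 1); rewrite ?ltry // ltrDl.
have l_gt0 : 0 < l by exact: lt_trans tl.
have bF y : enorm (y - x) <= l -> (b%:E < F y)%E.
  rewrite ltNge => yl; apply/negP => Fy; move: ld; apply/negP; rewrite -leNgt.
  apply: (@le_trans _ _ (enorm (x - y))%:E); last by rewrite lee_fin enormBC.
  by apply: dist_to_le; rewrite /sublevel /= Fb.
have [z [A [xi [zl /andP[A_gt0 Au] Fz xiP xi_le]]]] :=
  exists_small_proximal_subgrad F_lsc q01 u_gt0 l_gt0 Fx bF.
have zball : level_ball F xbar eta nu z.
  split; last first.
    by rewrite /= Fz Fb -EFinD !lte_fin ltrDl ltrD2l A_gt0 (le_lt_trans Au).
  (* [xbar] is in the sublevel set, so it is at distance at least [l] from [x]. *)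
  have lx : l <= enorm (x - xbar).
    rewrite -lee_fin ltW // (lt_le_trans ld) // dist_to_le //.
    by rewrite /sublevel /= lexx.
  rewrite /eball /= -(subrK x z) -addrA.
  apply: le_lt_trans (ler_enormD _ _) _.
  by move: xball; rewrite /eball /=; lra.
have := le_trans (kl z zball) (dist_to_le 0 (proximal_subdiff_sub_limiting xiP)).
rewrite Fz Fb -EFinB [b + A - b]addrC addKr poweR_EFin -EFinM lee_fin.
rewrite enormBC subr0 => /le_trans/(_ xi_le); rewrite subKr.
rewrite ler_pM2r ?powR_gt0 // => c1_le.
move: tl; apply/negP; rewrite -leNgt.
have -> : t = 2 / (1 - alpha) * (u `^ (1 - alpha) / l) * (l / c1).
  by rewrite /t; field; rewrite !gt_eqF.
by rewrite mulrA ler_pdivlMr // mulrC ler_wpM2r // ltW.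
Qed.

(** The exponent [gamma = alpha / (1 - alpha)] is the one for which
[((F x - F xbar) ^ (1 - alpha)) ^ gamma] is the power [alpha] of the KL
inequality. *)
Lemma level_error_bound_of_sharpness F xbar (alpha c1 c2 : R) x :
  0 < alpha < 1 -> 0 < c1 -> 0 < c2 ->
  (c1%:E * (F x - F xbar) `^ alpha <= dist_to 0 (limiting_subdiff F x))%E ->
  (dist_to x (sublevel F xbar) <= c2%:E * (F x - F xbar) `^ (1 - alpha))%E ->
  ((dist_to x (sublevel F xbar)) `^ (alpha / (1 - alpha)) <=
    (c2 `^ (alpha / (1 - alpha)) / c1)%:E *
      dist_to 0 (proximal_subdiff F x))%E.
Proof.
move=> /andP[a_gt0 a_lt1] c1_gt0 c2_gt0 kl sharp.
have q_gt0 : 0 < 1 - alpha by rewrite subr_gt0.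
set g := alpha / (1 - alpha); have g_gt0 : 0 < g by rewrite divr_gt0.
have c2_ge0 : (0 <= c2%:E)%E by rewrite lee_fin ltW.
have := @gt0_ler_poweR R g (ltW g_gt0) _ _ _ _ sharp.
rewrite !in_itv /= !leey !andbT dist_to_ge0 mule_ge0 ?poweR_ge0 //.
move=> /(_ isT isT)/le_trans; apply.
rewrite poweRM ?poweR_ge0 // -poweRrM mulrCA mulfV ?gt_eqF // mulr1 poweR_EFin.
rewrite EFinM -muleA lee_pmul2l ?lte_fin ?powR_gt0 //.
rewrite -(@lee_pmul2l _ c1%:E) ?lte_fin // muleA -EFinM mulfV ?gt_eqF // mul1e.
apply: le_trans kl _; apply: dist_to_subset.
exact: proximal_subdiff_sub_limiting.
Qed.

End LevelSets.

Theorem theorem7p2 (R : realType) (n : nat) (F : 'rV[R]_n -> \bar R)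
    (xbar : 'rV[R]_n) (eta nu alpha : R)
    (F_proper : proper_function F) (F_lsc : lower_semicontinuous F)
    (eta_gt0 : 0 < eta) (nu_gt0 : 0 < nu) (alpha01 : 0 < alpha < 1)
    (F_kl : kl_property F xbar alpha (level_ball F xbar eta nu)) :
  level_sharpness F xbar (1 - alpha) (level_ball F xbar (eta / 2) nu) /\
  (let gamma := alpha / (1 - alpha) in
   [/\ level_error_bound F xbar gamma (level_ball F xbar (eta / 2) nu),
       alpha = gamma / (1 + gamma),
       0 < alpha <= 1 / 2 <-> 0 < gamma <= 1
     & 1 / 2 < alpha < 1 <-> 1 < gamma]).
Proof.
have [c1 c1_gt0 kl] := F_kl; have /andP[a_gt0 a_lt1] := alpha01.
have q_gt0 : 0 < 1 - alpha by rewrite subr_gt0.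
have c2_gt0 : 0 < 2 / ((1 - alpha) * c1) by rewrite divr_gt0 // mulr_gt0.
have sharp x : level_ball F xbar (eta / 2) nu x ->
    (dist_to x (sublevel F xbar) <=
      (2 / ((1 - alpha) * c1))%:E * (F x - F xbar) `^ (1 - alpha))%E.
  exact: level_sharpness_of_kl.
split; first by split => //; exists (2 / ((1 - alpha) * c1)).
move=> gamma; have g_gt0 : 0 < gamma by rewrite divr_gt0.
split.
- split => //; exists ((2 / ((1 - alpha) * c1)) `^ gamma / c1).
    by rewrite divr_gt0 // powR_gt0.
  move=> x xball; have [xeta Fx] := xball.
  apply: level_error_bound_of_sharpness => //.
  + apply: kl; split => //; apply: lt_trans xeta _.
    by rewrite ltr_pdivrMr // ltr_pMr // ltr1n.
  + exact: sharp.
- rewrite /gamma; field; rewrite ?gt_eqF //=; lra.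
- rewrite a_gt0 g_gt0 /= /gamma ler_pdivrMr //; split; lra.
- rewrite a_lt1 andbT /gamma ltr_pdivlMr //; split; lra.
Qed.
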